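(* Let $(X,d)$ be a proper $\delta$-hyperbolic geodesic space ($\delta\ge 0$), and let $f:X\to\mathbb{R}$ be a $K$-convex $L$-Lipschitz function with $K>0$ and $L>0$ such that $\inf_X f$ is attained at some $p\in X$. Let $\tau>K^{-1}$. Then, given $\varepsilon>0$ and an arbitrary initial point $x_0\in X$, and choosing recursively $x_i\in\mathsf{J}^f_\tau(x_{i-1})$ for $i\ge 1$, we have \[ d^2(p,x_N)\le\frac{2L\tau}{K\tau-1}\left(\frac{4\sqrt{2\tau L\delta}}{\sqrt{K\tau+1}}+\varepsilon^2\right) \] for some $N<d(p,x_0)\,\varepsilon^{-2}$.
   Context: Let $(X,d)$ be a metric space. Proper: every bounded closed subset of $X$ is compact. Geodesic space: any two points $x,y\in X$ are joined by a (minimal) geodesic, i.e. a map $\gamma:[0,\ell]\to X$ with $\gamma(0)=x$, $\gamma(\ell)=y$ and $d(\gamma(s),\gamma(t))=(|s-t|/\ell)\,d(x,y)$ for all $s,t\in[0,\ell]$. Gromov product: $(x|y)_p:=\frac12\{d(p,x)+d(p,y)-d(x,y)\}$. The space $(X,d)$ is $\delta$-hyperbolic ($\delta\ge0$) if $(x|z)_p\ge\min\{(x|y)_p,(y|z)_p\}-\delta$ for all $p,x,y,z\in X$. $L$-Lipschitz: $|f(x)-f(y)|\le L\,d(x,y)$ for all $x,y\in X$. $K$-convex (in the weak geodesic sense): for any $x,y\in X$ there is some geodesic $\gamma:[0,1]\to X$ from $x$ to $y$ such that $f(\gamma(t))\le(1-t)f(x)+tf(y)-\frac K2(1-t)t\,d^2(x,y)$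 for all $t\in[0,1]$. Proximal (resolvent) operator: for $\tau>0$ and $x\in X$, $\mathsf{J}^f_\tau(x)$ is the set of all minimizers over $y\in X$ of $y\mapsto f(y)+\frac{d^2(x,y)}{2\tau}$; it is nonempty in this setting.
   Formalization: In the case x_0 = p, where no N ≥ 0 satisfies N < d(p,x_0) ε^{-2} = 0, the bound is asserted for N = 0 instead; for x_0 ≠ p the statement is as printed, with N = 0 allowed. *)

(* Defs.v *)
From mathcomp Require Export all_boot all_order all_algebra.
From mathcomp Require Export all_classical all_reals all_analysis.

Set Implicit Arguments.
Unset Strict Implicit.
Unset Printing Implicit Defensive.

Import Order.TTheory GRing.Theory Num.Theory.
Local Open Scope classical_set_scope.
Local Open Scope ring_scope.

Definition mbounded (R : realType) (X : metricType R) (A : set X) : Prop :=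
  exists M : R, forall x y, A x -> A y -> mdist x y <= M.

Definition proper_space (R : realType) (X : metricType R) : Prop :=
  forall A : set X, mbounded A -> closed A -> compact A.

(* A curve [0, l] -> X is a total function R -> X whose values outside [0, l]
   are irrelevant. *)
Definition is_geodesic (R : realType) (X : metricType R) (l : R) (g : R -> X)
    (x y : X) : Prop :=
  [/\ g 0 = x, g l = y &
      forall s t, 0 <= s <= l -> 0 <= t <= l ->
        mdist (g s) (g t) = `|s - t| / l * mdist x y].

Definition geodesic_space (R : realType) (X : metricType R) : Prop :=
  forall x y : X, exists (l : R) (g : R -> X), 0 < l /\ is_geodesic l g x y.

Definition gromov_product (R : realType) (X : metricType R) (p x y : X) : R :=
  2^-1 * (mdist p x + mdist p y - mdist x y).

Definition gromov_hyperbolic (R : realType) (X : metricType R) (delta : R) :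
    Prop :=
  forall p x y z : X,
    Num.min (gromov_product p x y) (gromov_product p y z) - delta
      <= gromov_product p x z.

Definition lipschitz_fun (R : realType) (X : metricType R) (L : R)
    (f : X -> R) : Prop :=
  forall x y, `|f x - f y| <= L * mdist x y.

(* Weak geodesic convexity: the inequality is required along some geodesic
   between any two points, not along all of them. *)
Definition weakly_convex (R : realType) (X : metricType R) (K : R)
    (f : X -> R) : Prop :=
  forall x y : X, exists g : R -> X, is_geodesic 1 g x y /\
    forall t, 0 <= t <= 1 ->
      f (g t) <= (1 - t) * f x + t * f y
                 - K / 2 * (1 - t) * t * mdist x y ^+ 2.

Definition minimizers (R : realType) (X : Type) (h : X -> R) : set X :=
  [set y | forall z, h y <= h z].

Definition resolvent (R : realType) (X : metricType R) (f : X -> R) (tau : R)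
    (x : X) : set X :=
  minimizers (fun y => f y + mdist x y ^+ 2 / (2 * tau)).

(* Main.v *)
From mathcomp Require Import ring lra.
Require Import Defs.

Set Implicit Arguments.
Unset Strict Implicit.
Unset Printing Implicit Defensive.

Import Order.TTheory GRing.Theory Num.Theory.
Local Open Scope classical_set_scope.
Local Open Scope ring_scope.

(* Let y be a resolvent point of x and put a = d(p, y), b = d(x, y),
   c = d(p, x).  Everything rests on two estimates: an upper bound, by a
   constant D, on the defect a + b - c in the triangle inequality, and the lower
   bound b >= (K tau - 1) / (2 L tau) * c^2 on the step.  Together they say that,
   as long as c^2 exceeds the claimed bound, one step brings us closer to p by
   more than eps^2, which cannot go on for d(p, x0) / eps^2 steps.

   For the defect, let s = (a + b - c) / 2 be the Gromov product (x | p)_y and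
   let z be the point at distance s from y on the geodesic from y to p.
   Hyperbolicity gives d(x, z) <= b - s + 2 delta, whereas convexity gives
   f(z) <= f(y) - K s^2 / 2; minimality of y then forces
   b^2 + K tau s^2 <= (b - s + 2 delta)^2.  Since b <= 2 L tau, this bounds s
   when s >= delta; when s < delta, the Lipschitz bound K s <= 2 L suffices. *)

Section ResolventStep.

Variables (R : realType) (X : metricType R).
Implicit Types (f : X -> R) (p x y z : X) (K L tau delta : R).

Lemma gromov_hyperbolic_four_point delta w x y z :
  gromov_hyperbolic X delta ->
  mdist x z + mdist w y <=
    Num.max (mdist x y + mdist w z) (mdist y z + mdist w x) + 2 * delta.
Proof.
move=> /(_ w x y z); rewrite /gromov_product.
by rewrite minElt maxElt; case: ifP => _; case: ifP => ?; lra.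
Qed.

(** Along a geodesic from [x] to [p], minimality of [p] gives [(1 - t) * (u - t * c) >= 0]; divide
    by [1 - t] and let [t] tend to 1. *)
Lemma weakly_convex_quadratic_growth f K p x :
  0 < K -> weakly_convex K f -> minimizers f p ->
  f p + K / 2 * mdist p x ^+ 2 <= f x.
Proof.
move=> K0 cvx pmin.
set c := K / 2 * mdist p x ^+ 2; set u := f x - f p.
have u0 : 0 <= u by rewrite subr_ge0; exact: pmin.
have slope t : 0 <= t < 1 -> t * c <= u.
  move=> t01; have [g [_ /(_ t)]] := cvx x p.
  rewrite metric_sym => gt.
  have fg : f (g t) <= (1 - t) * f x + t * f p - (1 - t) * t * c.
    rewrite (_ : (1 - t) * t * c = K / 2 * (1 - t) * t * mdist p x ^+ 2).
      by apply: gt; lra.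
    by rewrite /c; ring.
  have {fg} : 0 <= (1 - t) * (u - t * c).
    have := pmin (g t); rewrite /u; nra.
  by rewrite pmulr_rge0 ?subr_ge0 //; lra.
have [cu|uc] := leP c u; first by move: cu; rewrite /u; lra.
have c0 : 0 < c by exact: le_lt_trans uc.
(* In place of a limit: if [u < c], this [t] is below 1 and [t * c] is the midpoint of [u] and [c],
   hence exceeds [u]. *)
have := slope ((u + c) / (2 * c)).
have -> : (u + c) / (2 * c) * c = (u + c) / 2 by field; exact: lt0r_neq0.
have -> : 0 <= (u + c) / (2 * c) < 1.
  by rewrite divr_ge0 ?ltr_pdivrMr /=; lra.
by move=> /(_ isT); lra.
Qed.

Lemma resolvent_le f tau x y z : 0 < tau -> resolvent f tau x y ->
  2 * tau * f y + mdist x y ^+ 2 <= 2 * tau * f z + mdist x z ^+ 2.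
Proof.
move=> tau0 /(_ z) /=; rewrite -(ler_pM2l (_ : 0 < 2 * tau)); last by lra.
by rewrite !mulrDr !(mulrC (2 * tau) (_ / _)) !divfK // lt0r_neq0 //; lra.
Qed.

Lemma lipschitz_fun_le f L x y :
  lipschitz_fun L f -> f x <= f y + L * mdist x y.
Proof. by move=> /(_ x y); rewrite ler_norml; lra. Qed.

Lemma resolvent_step_le f L tau x y :
  0 < L -> 0 < tau -> lipschitz_fun L f -> resolvent f tau x y ->
  mdist x y <= 2 * tau * L.
Proof.
move=> L0 tau0 lip /(resolvent_le x tau0); rewrite mdistxx expr0n /= addr0.
have := lipschitz_fun_le x y lip; have := mdist_ge0 x y.
set b := mdist x y; rewrite le_eqVlt => /predU1P[<- _ _|b0 fxy fyx].
  by rewrite !mulr_ge0 //; lra.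
rewrite -(ler_pM2r b0); nra.
Qed.

(** Compare [y] with the competitor [p], and bound [f y - f p] below by quadratic growth at [x]
    minus the Lipschitz loss from [x] to [y]. *)
Lemma resolvent_step_ge f K L tau p x y :
  0 < K -> 0 < tau -> weakly_convex K f -> lipschitz_fun L f ->
  minimizers f p -> resolvent f tau x y ->
  (K * tau - 1) * mdist p x ^+ 2 <= 2 * L * tau * mdist x y.
Proof.
move=> K0 tau0 cvx lip pmin /(resolvent_le p tau0).
have := weakly_convex_quadratic_growth x K0 cvx pmin.
have := lipschitz_fun_le x y lip; rewrite (metric_sym x p) => H1 H2 H3.
have := sqr_ge0 (mdist x y); nra.
Qed.

Lemma defect_sqr_bound K L tau delta b s :
  0 < K -> 0 < L -> 0 < tau -> 0 <= delta ->
  0 < s <= b -> b <= 2 * tau * L -> K * s <= 2 * L ->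
  K * tau * s ^+ 2 <= (b - s + 2 * delta) ^+ 2 - b ^+ 2 ->
  (K * tau + 1) * s ^+ 2 <= 8 * tau * L * delta.
Proof.
move=> K0 L0 tau0 delta0 /andP[s0 sb] bL sL main.
have [ds|sd] := leP delta s.
  (* Expanded, [main] bounds the left side by [4 * delta * b - 2 * s * (b - s) - 4 * delta * (s -
     delta)]. *)
  have h1 : 0 <= delta * (s - delta) by rewrite mulr_ge0 //; lra.
  have h2 : 0 <= s * (b - s) by rewrite mulr_ge0 //; lra.
  have h3 : 0 <= delta * (2 * tau * L - b) by rewrite mulr_ge0 //; lra.
  by nra.
(* Both [K * tau * s ^+ 2] and [s ^+ 2] are at most [2 * tau * L * s], and [s < delta]. *)
have h1 : 0 <= (tau * s) * (2 * L - K * s).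
  by rewrite mulr_ge0 ?mulr_ge0 //; lra.
have h2 : 0 <= s * (2 * tau * L - s) by rewrite mulr_ge0 //; lra.
have h3 : 0 <= (tau * L) * (delta - s) by rewrite mulr_ge0 ?mulr_ge0 //; lra.
have h4 : 0 <= (tau * L) * delta by rewrite mulr_ge0 ?mulr_ge0 //; lra.
by nra.
Qed.

Lemma resolvent_defect f K L tau delta p x y :
  0 <= delta -> gromov_hyperbolic X delta ->
  0 < K -> 0 < L -> 0 < tau -> weakly_convex K f -> lipschitz_fun L f ->
  minimizers f p -> resolvent f tau x y ->
  mdist p y + mdist x y - mdist p x <=
    4 * Num.sqrt (2 * tau * L * delta) / Num.sqrt (K * tau + 1).
Proof.
move=> delta0 hyp K0 L0 tau0 cvx lip pmin res.
have Kt0 : 0 < K * tau + 1 by have := mulr_gt0 K0 tau0; lra.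
set a := mdist p y; set b := mdist x y; set c := mdist p x.
have [s sE] : exists s, a + b - c = 2 * s.
  by exists ((a + b - c) / 2); field.
rewrite sE.
have [s0|s0] := leP s 0.
  apply: (@le_trans _ _ 0); first by lra.
  by rewrite divr_ge0 ?mulr_ge0 ?sqrtr_ge0.
have sa : s <= a.
  have := metric_triangle x p y; rewrite -/b (metric_sym x p) -/a -/c; lra.
have sb : s <= b.
  have := metric_triangle p x y; rewrite -/b -/a -/c; lra.
have a0 : 0 < a by lra.
have [g [[g0 g1 gd] gcvx]] := cvx y p.
pose t := s / a; have ta : t * a = s by rewrite divfK // lt0r_neq0.
have t01 : 0 <= t <= 1.
  by rewrite divr_ge0 ?ler_pdivrMr ?mul1r //; lra.
have yz : mdist y (g t) = s.
  rewrite -g0 gd ?lexx ?ler01 // sub0r normrN divr1 ger0_norm; last by lra.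
  by rewrite (metric_sym y) -/a.
have zp : mdist p (g t) = a - s.
  rewrite -g1 metric_sym gd ?lexx ?ler01 // divr1 distrC ger0_norm; last by lra.
  by rewrite (metric_sym y) -/a mulrBl mul1r ta.
(* Convexity and quadratic growth at [y] give a drop of at least [K * s * a - K / 2 * s ^+ 2]; then
   use [s <= a]. *)
have fz : f (g t) <= f y - K / 2 * s ^+ 2.
  have := gcvx _ t01; rewrite (metric_sym y) -/a.
  rewrite (_ : K / 2 * (1 - t) * t * a ^+ 2 = K / 2 * (t * a) * (a - t * a));
    last by ring.
  have := weakly_convex_quadratic_growth y K0 cvx pmin; rewrite -/a ta => H1 H2.
  have H3 : 0 <= t * (f y - (f p + K / 2 * a ^+ 2)) by rewrite mulr_ge0 //; lra.
  have H4 : t * (K / 2 * a ^+ 2) = K / 2 * s * a by rewrite -ta; ring.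
  have H5 : 0 <= K * s * (a - s) by rewrite mulr_ge0 ?mulr_ge0 //; lra.
  nra.
have KsL : K * s <= 2 * L.
  have := lipschitz_fun_le y (g t) lip; rewrite yz => H.
  by rewrite -(ler_pM2r s0); nra.
(* The choice of [s] makes the two terms of the maximum equal: [c + s = a + b - s]. *)
have xz : mdist x (g t) <= b - s + 2 * delta.
  have := gromov_hyperbolic_four_point y x p (g t) hyp.
  rewrite yz zp (metric_sym y p) (metric_sym y x) (metric_sym x p) -/a -/b -/c.
  by rewrite maxElt; case: ifP => _; lra.
have bL : b <= 2 * tau * L by apply: resolvent_step_le res.
have main : K * tau * s ^+ 2 <= (b - s + 2 * delta) ^+ 2 - b ^+ 2.
  have := resolvent_le (g t) tau0 res; rewrite -/b => H.
  have : mdist x (g t) ^+ 2 <= (b - s + 2 * delta) ^+ 2.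
    by rewrite ler_sqr ?nnegrE ?mdist_ge0 //; lra.
  have : 0 <= tau * (f y - K / 2 * s ^+ 2 - f (g t)) by rewrite mulr_ge0 //; lra.
  by lra.
have sqr := defect_sqr_bound K0 L0 tau0 delta0
  (introT andP (conj s0 sb)) bL KsL main.
rewrite ler_pdivlMr ?sqrtr_gt0 //.
have W0 : 0 <= 2 * tau * L * delta by rewrite !mulr_ge0 //; lra.
suff : s * Num.sqrt (K * tau + 1) <= 2 * Num.sqrt (2 * tau * L * delta) by lra.
rewrite -ler_sqr ?nnegrE ?mulr_ge0 ?sqrtr_ge0 ?(ltW s0) //.
by rewrite !exprMn !sqr_sqrtr ?(ltW Kt0) //; lra.
Qed.

End ResolventStep.
(* In the degenerate case x0 = p no natural number is < d(p, x0) / eps^2 = 0;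
   the second disjunct says that the bound then holds at N = 0. For x0 <> p
   only the first disjunct can hold. *)
Theorem corollary1p2 (R : realType) (X : metricType R) (delta : R)
    (f : X -> R) (K L : R) (p : X) (tau : R) (eps : R)
    (x0 : X) (x : nat -> X) :
  0 <= delta ->
  proper_space X ->
  geodesic_space X ->
  gromov_hyperbolic X delta ->
  0 < K -> 0 < L ->
  weakly_convex K f ->
  lipschitz_fun L f ->
  minimizers f p ->
  K^-1 < tau ->
  0 < eps ->
  x 0%N = x0 ->
  (forall i : nat, (1 <= i)%N -> resolvent f tau (x i.-1) (x i)) ->
  exists N : nat,
    (N%:R < mdist p x0 / eps ^+ 2 \/ x0 = p /\ N = 0%N) /\
    mdist p (x N) ^+ 2 <=
      2 * L * tau / (K * tau - 1) *
      (4 * Num.sqrt (2 * tau * L * delta) / Num.sqrt (K * tau + 1) + eps ^+ 2).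
Proof.
move=> delta0 _ _ hyp K0 L0 cvx lip pmin Ktau eps0 xE res.
have tau0 : 0 < tau by rewrite (lt_trans _ Ktau) // invr_gt0.
have Kt1 : 0 < K * tau - 1.
  by rewrite subr_gt0 -(mulfV (lt0r_neq0 K0)) ltr_pM2l.
set D := 4 * _ / _.
have D0 : 0 <= D by rewrite divr_ge0 ?mulr_ge0 ?sqrtr_ge0.
set B := _ * (D + _).
have B0 : 0 <= B.
  by rewrite mulr_ge0 ?addr_ge0 ?sqr_ge0 // divr_ge0 ?(ltW Kt1) // !mulr_ge0 // ltW.
have e20 : 0 < eps ^+ 2 by rewrite exprn_gt0.
have [x0p|x0p] := eqVneq x0 p.
  by exists 0%N; split; [right|rewrite xE x0p mdistxx expr0n].
have decrease i : B < mdist p (x i) ^+ 2 ->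
    mdist p (x i.+1) < mdist p (x i) - eps ^+ 2.
  move=> far; have resi := res i.+1 isT.
  have := resolvent_defect delta0 hyp K0 L0 tau0 cvx lip pmin resi.
  have := resolvent_step_ge K0 tau0 cvx lip pmin resi.
  rewrite /= -/D => step defect.
  suff : D + eps ^+ 2 < mdist (x i) (x i.+1) by lra.
  have Lt0 : 0 < 2 * L * tau by rewrite !mulr_gt0.
  rewrite -(ltr_pM2l Lt0) (lt_le_trans _ step) //.
  have -> : 2 * L * tau * (D + eps ^+ 2) = (K * tau - 1) * B.
    by rewrite /B; field; exact: lt0r_neq0.
  by rewrite ltr_pM2l.
apply: contrapT => none.
have far N : N%:R < mdist p x0 / eps ^+ 2 -> B < mdist p (x N) ^+ 2.
  move=> NE; rewrite ltNge; apply/negP => close; apply: none.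
  by exists N; split=> //; left.
have descent N : N%:R < mdist p x0 / eps ^+ 2 ->
    mdist p (x N.+1) < mdist p x0 - N.+1%:R * eps ^+ 2.
  elim: N => [|N IH] NE; have := decrease _ (far _ NE).
    by rewrite xE mul1r.
  have /IH : N%:R < mdist p x0 / eps ^+ 2 by rewrite (lt_trans _ NE) ?ltr_nat.
  by rewrite -[N.+2%:R]natr1; lra.
have d0 : 0 < mdist p x0 by rewrite mdist_gt0 eq_sym.
(* [N] is the last index below [mdist p x0 / eps ^+ 2]; [descent] there would make the distance at
   [N.+1] negative. *)
have [N /andP[lo hi]] : exists N : nat,
    N%:R < mdist p x0 / eps ^+ 2 <= N.+1%:R.
  pose P n := mdist p x0 / eps ^+ 2 <= n%:R.
  have exP : exists n, P n.
    exists (Num.bound (mdist p x0 / eps ^+ 2)).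
    by rewrite /P ltW // archi_boundP // divr_ge0 ?mdist_ge0 ?sqr_ge0.
  case: (ex_minnP exP) => [[|n]] Pn Pmin.
    by move: Pn; rewrite /P leNgt divr_gt0.
  exists n; apply/andP; split=> //; rewrite ltNge; apply/negP => Pn'.
  by have := Pmin n Pn'; rewrite ltnn.
have := mdist_ge0 p (x N.+1); rewrite leNgt => /negP; apply.
by have := descent _ lo; move: hi; rewrite ler_pdivrMr //; lra.
Qed.
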